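(* For any integer $d\ge 2$ and any integer $i$ with $0\le i\le d-1$, $$\lim_{k\to\infty}\ \zeta(k)^{-1}\sum_{\substack{2\le r\le k-1\\ r\equiv i \bmod d}}\zeta(r,k-r)\;=\;\sum_{\substack{j\ge 2\\ j\equiv i\bmod d}}\bigl(\zeta(j)-1\bigr),$$ where $k$ runs over the positive integers.
   Context: For integers $r\ge2$, $s\ge1$, the double zeta value is $\zeta(r,s)=\sum_{m>n>0}\frac{1}{m^r n^s}$ (sum over integers); $\zeta(k)$ is the Riemann zeta value. *)

(* Defs.v *)
From HB Require Import structures.
From mathcomp Require Import all_boot all_order all_algebra.
From mathcomp Require Import all_classical all_reals all_analysis.

Set Implicit Arguments.
Unset Strict Implicit.
Unset Printing Implicit Defensive.

Import Order.TTheory GRing.Theory Num.Theory.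
Import numFieldNormedType.Exports.

Local Open Scope classical_set_scope.
Local Open Scope ring_scope.

(* All the series have nonnegative terms, so they are valued in \bar R, where
   each sum is meaningful without a convergence proof; the values are finite
   for 2 <= k, and for 2 <= r and 1 <= s respectively. *)
Definition zeta (R : realType) (k : nat) : \bar R :=
  (\sum_(1 <= n <oo) ((n%:R ^- k)%R)%:E)%E.

Definition double_zeta (R : realType) (r s : nat) : \bar R :=
  \esum_(p in [set p : nat * nat | (0 < p.2 < p.1)%N])
    (p.1%:R ^- r * p.2%:R ^- s)%:E.

Arguments zeta : clear implicits.
Arguments double_zeta : clear implicits.

(* Main.v *)
(** The pairs (m, n) with n = 1 contribute exactly zeta(r) - 1 to zeta(r, k-r),
    so they give the partial sums of the limit series. For n >= 2, summing
    over r telescopes: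
      (n^-1 - m^-1) sum_r m^-r n^-(k-r) <= m^-2 n^-(k-1),
    so this part is at most 2^-(k-4) sum_(m > n >= 2) (m - n)^-2 n^-2, which
    tends to 0. Finally zeta(k) tends to 1. *)

Require Import Defs.
From HB Require Import structures.
From mathcomp Require Import all_boot all_order all_algebra.
From mathcomp Require Import all_classical all_reals all_analysis.
From mathcomp Require Import ring lra.
Import Order.TTheory GRing.Theory Num.Theory.
Import numFieldNormedType.Exports.
Local Open Scope classical_set_scope.
Local Open Scope ring_scope.

(** Multiplied by [b - a], each term becomes a difference of consecutive values of [f]. The sum
    collapses to [a ^+ 2 * b ^+ (k - 1) - a ^+ k * b], and the subtracted term is nonnegative. *)
Lemma sum_exprM_subn_le (R : realFieldType) (a b : R) (k : nat) :
  0 < a -> a < b -> (2 <= k)%N ->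
  \sum_(2 <= r < k) a ^+ r * b ^+ (k - r) <= a ^+ 2 * b ^+ (k - 1) / (b - a).
Proof.
move=> a0 ab k2; have ba0 : 0 < b - a by rewrite subr_gt0.
rewrite ler_pdivlMr// mulr_suml.
pose f r : R := - (a ^+ r * b ^+ (k.+1 - r)).
rewrite (@eq_big_nat _ _ _ _ _ _ (fun r => f r.+1 - f r)); last first.
  move=> r /andP[_ rk]; rewrite /f subSS subSn ?(ltnW rk)// !exprS; ring.
rewrite telescope_sumr// /f opprK subSS gerDr oppr_le0.
by rewrite mulr_ge0// exprn_ge0// ltW// (lt_trans a0).
Qed.

Lemma sum_pair_le (R : realFieldType) (m n k : nat) :
  (1 < n < m)%N -> (4 <= k)%N ->
  \sum_(2 <= r < k) m%:R ^- r * n%:R ^- (k - r) <=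
    2 ^- (k - 4) * ((m - n)%N%:R ^- 2 * n%:R ^- 2) :> R.
Proof.
move=> /andP[n1 nm] k4.
have n0 : 0 < n%:R :> R by rewrite ltr0n (ltn_trans _ n1).
have m0 : 0 < m%:R :> R by rewrite ltr0n (ltn_trans _ nm)// (ltn_trans _ n1).
have nmR : n%:R < m%:R :> R by rewrite ltr_nat.
have mn0 : 0 < m%:R - n%:R :> R by rewrite subr_gt0.
under eq_bigr do rewrite -!exprVn.
apply: (le_trans (@sum_exprM_subn_le R m%:R^-1 n%:R^-1 k _ _ _)) => //.
- by rewrite invr_gt0.
- by rewrite ltf_pV2.
- exact: leq_trans k4.
rewrite natrB ?(ltnW nm)// -!exprVn.
(* Of the [k - 1] factors 1/n, one cancels against 1/n - 1/m = (m - n)/(mn), two are kept for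
   summability in n, and the remaining [k - 4] are bounded by 1/2 each. *)
have -> : (k - 1 = (k - 4) + 3)%N by rewrite -[in LHS](subnK k4) -addnBA.
rewrite exprD.
have -> : m%:R^-1 ^+ 2 * (n%:R^-1 ^+ (k - 4) * n%:R^-1 ^+ 3) /
    (n%:R^-1 - m%:R^-1) =
  n%:R^-1 ^+ (k - 4) * ((m%:R^-1 * (m%:R - n%:R)^-1) * n%:R^-1 ^+ 2) :> R.
  by field; rewrite !gt_eqF.
apply: ler_pM.
- by rewrite exprn_ge0// invr_ge0 ltW.
- by rewrite !mulr_ge0 ?exprn_ge0 ?invr_ge0// ltW.
- by rewrite lerXn2r ?nnegrE ?invr_ge0 ?ler0n// lef_pV2 ?posrE// ler_nat.
rewrite ler_wpM2r ?exprn_ge0 ?invr_ge0 ?(ltW n0)// expr2.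
by rewrite ler_wpM2r ?invr_ge0 ?(ltW mn0)// lef_pV2 ?posrE// gerBl ltW.
Qed.

Lemma sum_inv_square_le (R : realFieldType) (N : nat) :
  \sum_(1 <= n < N) n%:R ^- 2 <= 2 :> R.
Proof.
case: N => [|N]; first by rewrite big_geq.
(* The bound 2 alone is not inductive. The correction 1/(N + 1/2) works because 1/n^2 < 1/(n^2 -
   1/4) = 1/(n - 1/2) - 1/(n + 1/2). *)
suff : \sum_(1 <= n < N.+1) n%:R ^- 2 <= 2 - 2 / (2 * N%:R + 1) :> R.
  by move/le_trans; apply; rewrite gerBl divr_ge0// addr_ge0// mulr_ge0.
elim: N => [|N IH]; first by rewrite big_geq// mulr0 add0r divr1 subrr.
rewrite big_nat_recr//=; apply: (le_trans (lerD IH (lexx _))).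
have N0 : 0 <= N%:R :> R by rewrite ler0n.
rewrite -natr1; set x : R := N%:R in N0 *.
rewrite -subr_ge0 (_ : _ - _ =
  ((2 * x + 1) * (2 * (x + 1) + 1) * (x + 1) ^+ 2)^-1); last first.
  field; rewrite !gt_eqF//; lra.
by rewrite invr_ge0 !mulr_ge0// ?sqr_ge0//; lra.
Qed.

Local Open Scope ereal_scope.

Lemma eseries_esum (R : realType) (N : nat) (f : nat -> \bar R) :
  (forall n, (N <= n)%N -> 0 <= f n) ->
  \sum_(N <= n <oo) f n = \esum_(n in [set n | (N <= n)%N]) f n.
Proof. by move=> f0; rewrite eseries_cond nneseries_esum. Qed.

Lemma esumZl (R : realType) (T : choiceType) (D : set T) (r : R)
    (f : T -> \bar R) : (0 <= r)%R -> (forall x, 0 <= f x) ->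
  \esum_(x in D) (r%:E * f x) = r%:E * \esum_(x in D) f x.
Proof.
move=> r0 f0; rewrite /esum -ereal_supZl//; last first.
  apply/set0P; exists (\sum_(x \in set0) f x); exists set0 => //.
  exact: fsets_set0.
rewrite image_comp; congr ereal_sup.
by apply: eq_imagel => A _ /=; rewrite ge0_mule_fsumr.
Qed.

(** All error bounds below are multiples of constants built from [zeta R 2]; its finiteness excludes
    products 0 * oo in the limit. *)
Lemma zeta2_fin_num (R : realType) : zeta R 2 \is a fin_num.
Proof.
rewrite ge0_fin_numE; last by apply: nneseries_ge0 => n _ _; rewrite lee_fin.
apply: (@le_lt_trans _ _ 2%:E); last exact: ltry.
apply: lime_le.
  by apply: is_cvg_nneseries => n _ _; rewrite lee_fin.
by apply: nearW => N; rewrite sumEFin lee_fin sum_inv_square_le.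
Qed.

Lemma zetaB1 (R : realType) (k : nat) :
  zeta R k - 1 = \sum_(2 <= n <oo) (n%:R ^- k)%:E.
Proof.
rewrite /zeta (nneseries_split 1 1); last by move=> n _; rewrite lee_fin.
by rewrite big_nat1 expr1n invr1 [X in X - 1]addeC addeK.
Qed.

Lemma zetaB1_ge0 (R : realType) (k : nat) : 0 <= zeta R k - 1.
Proof. by rewrite zetaB1; apply: nneseries_ge0 => n _ _; rewrite lee_fin. Qed.

(** Termwise: n >= 2 lets [k - 2] of the factors 1/n be replaced by 1/2. *)
Lemma zetaB1_le (R : realType) (k : nat) : (2 <= k)%N ->
  zeta R k - 1 <= (2 ^- (k - 2))%:E * (zeta R 2 - 1).
Proof.
move=> k2; rewrite !zetaB1 -nneseriesZl; last by move=> n _; rewrite lee_fin.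
rewrite !eseries_esum; [|by move=> n _; rewrite -?EFinM lee_fin..].
apply: le_esum => n /= n2; rewrite -EFinM lee_fin.
rewrite -[in leLHS](subnK k2) exprD invfM ler_wpM2r//.
rewrite lef_pV2 ?posrE ?exprn_gt0 ?ltr0n ?(ltn_trans _ n2)//.
by rewrite lerXn2r ?nnegrE// ler_nat.
Qed.

Lemma cvg_half_exprMl (R : realType) (m : nat) (c : \bar R) : c \is a fin_num ->
  (2 ^- (k - m))%:E * c @[k --> \oo] --> (0 : \bar R).
Proof.
move=> cfin; rewrite -(mul0e c); apply: cvgeM.
- exact: mule_def_fin.
- apply: cvg_EFin; first exact: nearW.
  (* For k < m the truncated [k - m] is 0; shifting by [m] skips these terms and leaves a geometric
     sequence. *)
  rewrite -(cvg_shiftn m)/=; under eq_fun do rewrite addnK -exprVn.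
  by apply: cvg_expr; rewrite ger0_norm ?invr_ge0// invf_lt1//; lra.
- exact: cvg_cst.
Qed.

Lemma cvg_zeta (R : realType) : zeta R k @[k --> \oo] --> (1 : \bar R).
Proof.
have E k : zeta R k = 1 + (zeta R k - 1) by rewrite addeC subeK.
rewrite (funext E) -[X in _ --> X](adde0 1).
apply: cvgeD => //; first exact: cvg_cst.
apply: (@squeeze_cvge _ _ _ _ (cst 0) _
  (fun k => (2 ^- (k - 2))%:E * (zeta R 2 - 1))).
- near=> k; rewrite zetaB1_ge0 zetaB1_le//; near: k; exact: nbhs_infty_ge.
- exact: cvg_cst.
- by apply: cvg_half_exprMl; rewrite fin_numB zeta2_fin_num.
Unshelve. all: by end_near. Qed.

Lemma cvg_inve_zeta (R : realType) :
  (zeta R k)^-1 @[k --> \oo] --> (1 : \bar R).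
Proof.
have /fine_cvgP[fz z1] := cvg_zeta R.
apply/fine_cvgP.
(* The extended inverse is the real one at finite nonzero values, and [zeta R k] is eventually
   finite and always at least 1. *)
have near_inv : \forall k \near \oo, (zeta R k)^-1 = ((fine (zeta R k))^-1)%:E.
  near=> k.
  have fk : zeta R k \is a fin_num by near: k.
  rewrite -{1}(fineK fk) inver gt_eqF// -lte_fin fineK//.
  by rewrite (lt_le_trans lte01)// -sube_ge0 ?fk ?orbT// zetaB1_ge0.
split; first by apply: filterS near_inv => k ->.
have := cvgV (oner_neq0 R) z1; rewrite invr1 => z1V.
apply: (cvg_trans _ (z1V _)).
by apply: near_eq_cvg; apply: filterS near_inv => k /= ->.
Unshelve. all: by end_near. Qed.

Definition double_zeta_ge2 (R : realType) (r s : nat) : \bar R :=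
  \esum_(p in [set p : nat * nat | (1 < p.2 < p.1)%N])
    (p.1%:R ^- r * p.2%:R ^- s)%:E.

Lemma double_zetaE (R : realType) (r s : nat) :
  double_zeta R r s = (zeta R r - 1) + double_zeta_ge2 R r s.
Proof.
have t0 (p : nat * nat) : (0 <= (p.1%:R ^- r * p.2%:R ^- s)%:E :> \bar R)%E.
  by rewrite lee_fin mulr_ge0.
rewrite /double_zeta (esumID [set p | p.2 = 1%N])//; congr (_ + _).
  rewrite zetaB1 eseries_esum; last by move=> n _; rewrite lee_fin.
  rewrite (reindex_esum [set n | (2 <= n)%N] _ (fun n => (n, 1%N))).
    by apply: eq_esum => n _ /=; rewrite expr1n invr1 mulr1.
  split => [n /= ->//|n n' _ _ [->]//|[m n] /= [/andP[_ nm] n1]].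
  by exists m; rewrite -?n1.
congr esum; apply/seteqP; split => [[m n]|[m n]] /=.
  by move=> [/andP[n0 nm] /eqP n1]; rewrite nm andbT ltn_neqAle eq_sym n1.
move=> /andP[n1 nm]; rewrite nm (ltnW n1) andbT; split=> // n1'.
by rewrite n1' in n1.
Qed.

(** The substitution x = m - n, y = n is a bijection onto the product set x >= 1, y >= 2, over which
    the double sum factors. *)
Lemma esum_distance_square (R : realType) :
  \esum_(p in [set p : nat * nat | (1 < p.2 < p.1)%N])
    ((p.1 - p.2)%N%:R ^- 2 * p.2%:R ^- 2)%:E
  = zeta R 2 * (zeta R 2 - 1) :> \bar R.
Proof.
rewrite (reindex_esum
  ([set n | (1 <= n)%N] `*`` (fun=> [set n | (2 <= n)%N])) _
  (fun p => ((p.1 + p.2)%N, p.2))); last first.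
  split => [[x y] /= [x1 y2]|[x y] [x' y'] _ _ /= [exy eyy]|
    [m n] /= /andP[n1 nm]].
  - by rewrite y2 -[ltnLHS]add0n ltn_add2r.
  - by rewrite -eyy in exy *; rewrite (addIn exy).
  - by exists (m - n, n)%N => /=; rewrite ?subn_gt0 ?subnK// ltnW.
under eq_esum do rewrite /= addnK.
rewrite -(@esum_esum _ _ _ _ _
  (fun x y => (x%:R ^- 2 * y%:R ^- 2)%:E)); last first.
  by move=> x y _ _; rewrite lee_fin mulr_ge0.
set S := \esum_(y in [set n | (2 <= n)%N]) (y%:R ^- 2)%:E : \bar R.
have SE : zeta R 2 - 1 = S by rewrite zetaB1 eseries_esum.
have Sfin : S \is a fin_num by rewrite -SE fin_numB zeta2_fin_num.
rewrite SE muleC /zeta eseries_esum; last by move=> n _; rewrite lee_fin.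
have S0 : 0 <= S by apply: esum_ge0 => n _; rewrite lee_fin.
(* [esumZl] takes a real scalar, so the inner sum [S] is first written as the image of its [fine]
   part. *)
rewrite -(fineK Sfin) -esumZl ?fine_ge0//.
by apply: eq_esum => x _; rewrite fineK// muleC -esumZl.
Qed.

(** By nonnegativity the sum over r moves inside the sum over pairs, where [sum_pair_le] applies to
    each pair; restricting r to [P] only drops nonnegative terms. *)
Lemma sum_double_zeta_ge2_le (R : realType) (P : pred nat) (k : nat) :
  (4 <= k)%N ->
  \sum_(2 <= r < k | P r) double_zeta_ge2 R r (k - r) <=
    (2 ^- (k - 4))%:E * (zeta R 2 * (zeta R 2 - 1)).
Proof.
move=> k4; rewrite -esum_distance_square -esumZl//.
rewrite /double_zeta_ge2 -esum_sum; last first.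
  by move=> p r _ _; rewrite lee_fin mulr_ge0.
apply: le_esum => p /= np; rewrite -EFinM sumEFin lee_fin.
apply: (le_trans _ (sum_pair_le _ _ _ _ np k4)).
rewrite big_mkcond; apply: ler_sum => r _.
by case: ifP => // _; rewrite mulr_ge0.
Qed.

Lemma cvg_sum_double_zeta (R : realType) (P : pred nat) :
  (zeta R k)^-1 * (\sum_(2 <= r < k | P r) double_zeta R r (k - r)%N)
    @[k --> \oo] -->
  \sum_(2 <= j <oo | P j) (zeta R j - 1).
Proof.
set L : \bar R := \sum_(2 <= j <oo | P j) (zeta R j - 1); rewrite -(mul1e L).
(* The product of the limits is well defined because 1 is finite and nonzero. *)
apply: cvgeM; first by rewrite mule_defE abse1 onee_eq0 /= andbF.
  exact: cvg_inve_zeta.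
under eq_fun do under eq_bigr do rewrite double_zetaE.
under eq_fun do rewrite big_split.
(* The terms [zeta R r - 1] with r < k form exactly a partial sum of [L]; the pairs with n >= 2 are
   squeezed to 0. *)
rewrite -(adde0 L); apply: cvgeD => //.
- exact: fin_num_adde_defl.
- by apply: is_cvg_nneseries => n _ _; exact: zetaB1_ge0.
apply: (@squeeze_cvge _ _ _ _ (cst 0) _
  (fun k => (2 ^- (k - 4))%:E * (zeta R 2 * (zeta R 2 - 1)))).
- near=> k; rewrite sume_ge0 ?sum_double_zeta_ge2_le//.
    by near: k; exact: nbhs_infty_ge.
  by move=> r _; apply: esum_ge0 => p _; rewrite lee_fin mulr_ge0.
- exact: cvg_cst.
- by apply: cvg_half_exprMl; apply: fin_numM; rewrite ?fin_numB zeta2_fin_num.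
Unshelve. all: by end_near. Qed.

Theorem theorem6 (R : realType) (d i : nat) (hd : (2 <= d)%N)
    (hi : (i <= d - 1)%N) :
  (zeta R k)^-1 *
    (\sum_(2 <= r < k | r == i %[mod d]) double_zeta R r (k - r)%N)
    @[k --> \oo] -->
  \sum_(2 <= j <oo | j == i %[mod d]) (zeta R j - 1).
Proof. exact: (cvg_sum_double_zeta R (fun j => j == i %[mod d])). Qed.
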